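(* Let $\mathcal{T}$ be a first-order theory with domain $\mathbb{D}$ whose $\exists^*\forall^*$-fragment is decidable, and let $\varphi_{\mathcal{T}}(\overline{x},\overline{y})$ be an $\mathrm{LTL}_{\mathcal{T}}$ specification with literals $l_1,\dots,l_n$, environment variables $\overline{x}$ and system variables $\overline{y}$. Let $\varphi_{\mathbb{B}}$ be its Boolean abstraction, let $C_{\mathbb{B}}=\langle Q,q_0,\delta,o\rangle$ be a winning controller for $\varphi_{\mathbb{B}}$, and let $S_{\mathcal{T}}$ be the shield built from $C_{\mathbb{B}}$ as follows. At each step, given the environment input $v_{\overline{x}}$ and the output $v_{\overline{y}}$ proposed by an external controller $D$: the partitioner computes the unique valid reaction $r$ with $f_r(v_{\overline{x}})$ true and the corresponding Boolean input $v_{\overline{e}}$ ($e_r$ true, all other $e$ false); $C_{\mathbb{B}}$ in its current state $q$ outputs $o(q,v_{\overline{e}})$, with associated choice $c$, and moves to $\delta(q,v_{\overline{e}})$; if $f_r(v_{\overline{x}})\rightarrow f_c(v_{\overline{x}},v_{\overline{y}})$ is true in $\mathcal{T}$ then $S_{\mathcal{T}}$ outputs $v_{\overline{y}}$, and otherwise it outputs some $v_{\overline{y}}'$ making $f_r(v_{\overline{x}})\rightarrow f_c(v_{\overline{x}},v_{\overline{y}}')$ true. Then for every external controller $D$ (producing values in $\mathbb{D}$), the composition $D\cdot S_{\mathcal{T}}$ is a controller for $\varphi_{\mathcal{T}}$: every trace produced by $D\cdot S_{\mathcal{T}}$ (environment inputs paired with the outputs of $S_{\mathcal{T}}$) satisfies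 $\varphi_{\mathcal{T}}$.
   Context: $\mathrm{LTL}_{\mathcal{T}}$ is LTL (operators $\neg,\vee,\bigcirc,\mathcal{U}$ and derived ones) where atomic propositions are replaced by literals of $\mathcal{T}$. A trace is an infinite sequence of valuations of $\overline{x}\cup\overline{y}$ in $\mathbb{D}$; each valuation determines truth values of the literals, and the formula is evaluated with the usual LTL semantics. In the synthesis game, at each step the environment chooses a valuation of $\overline{x}$ and the system responds with a valuation of $\overline{y}$. A Boolean controller for an LTL formula over environment propositions $\overline{e}$ and system propositions $\overline{s}$ is $\langle Q,q_0,\delta,o\rangle$ with $Q$ finite, $\delta:Q\times \mathrm{val}(\overline{e})\to Q$, $o:Q\times\mathrm{val}(\overline{e})\to\mathrm{val}(\overline{s})$; it is winning if all plays according to it satisfy the formula. Boolean abstraction: introduce fresh system propositions $s_1,\dots,s_n$, $s_i$ standing for $l_i$. A choice is a set $c\subseteq\{s_1,\dots,s_n\}$, identified with the valuation of $\overline{s}$ making exactly the $s_i\in c$ true; its characteristic formula is $f_c(\overline{x},\overline{y})=\bigwedge_{s_i\in c}l_i\wedge\bigwedge_{s_i\notin c}\neg l_i$. A reaction is a set $r$ of choices, with characteristic formula $f_r(\overline{x})=\bigwedge_{c\in r}\exists\overline{y}.f_c\wedge\bigwedge_{c\notin r}\forall\overline{y}.\neg f_c$; $r$ is valid if $\exists\overline{x}.f_r(\overline{x})$ is true in $\mathcal{T}$, and $\mathit{VR}$ is the set of valid reactions. Every valuation of $\overline{x}$ satisfies $f_r$ for exactly one $r\in\mathit{VR}$. For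 each $r\in\mathit{VR}$ introduce a fresh environment proposition $e_r$; $\varphi^{legal}$ says exactly one $e_r$ is true, and $\varphi^{extra}=\bigwedge_{r}(e_r\rightarrow\bigvee_{c\in r}(\bigwedge_{s_i\in c}s_i\wedge\bigwedge_{s_i\notin c}\neg s_i))$. The Boolean abstraction is $\varphi_{\mathbb{B}}=\varphi_{\mathcal{T}}[l_i\leftarrow s_i]\wedge\square(\varphi^{legal}\rightarrow\varphi^{extra})$, an LTL formula that is equi-realizable with $\varphi_{\mathcal{T}}$. *)

(* Defs.v *)
From HB Require Import structures.
From mathcomp Require Import all_boot.
From mathcomp Require Import boolp.

Set Implicit Arguments.
Unset Strict Implicit.
Unset Printing Implicit Defensive.

Record signature := Signature {
  fun_sym : countType;
  fun_arity : fun_sym -> nat;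
  rel_sym : countType;
  rel_arity : rel_sym -> nat }.

Section Syntax.
Variables (Sg : signature) (V : countType).

Inductive term :=
| TVar of V
| TApp (f : fun_sym Sg) of {ffun 'I_(fun_arity f) -> term}.

Inductive formula :=
| FRel (p : rel_sym Sg) of {ffun 'I_(rel_arity p) -> term}
| FTrue
| FNot of formula
| FAnd of formula & formula
| FOr of formula & formula
| FImp of formula & formula
| FEx of V & formula
| FAll of V & formula.

Fixpoint term_vars (t : term) : seq V :=
  match t with
  | TVar v => [:: v]
  | TApp f a => flatten [seq term_vars (a i) | i <- enum 'I_(fun_arity f)]
  end.

Fixpoint free_vars (phi : formula) : seq V :=
  match phi with
  | FRel p a => flatten [seq term_vars (a i) | i <- enum 'I_(rel_arity p)]
  | FTrue => [::]
  | FNot f => free_vars f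
  | FAnd f g | FOr f g | FImp f g => free_vars f ++ free_vars g
  | FEx v f | FAll v f => [seq w <- free_vars f | w != v]
  end.

Fixpoint quantifier_free (phi : formula) : bool :=
  match phi with
  | FRel _ _ | FTrue => true
  | FNot f => quantifier_free f
  | FAnd f g | FOr f g | FImp f g => quantifier_free f && quantifier_free g
  | FEx _ _ | FAll _ _ => false
  end.

Definition FExs (vs : seq V) (phi : formula) : formula := foldr FEx phi vs.
Definition FAlls (vs : seq V) (phi : formula) : formula := foldr FAll phi vs.
Definition FConj (s : seq formula) : formula := foldr FAnd FTrue s.

Definition EA_sentence (phi : formula) : Prop :=
  free_vars phi = [::] /\
  exists (vs ws : seq V) (psi : formula),
    quantifier_free psi /\ phi = FExs vs (FAlls ws psi).

Inductive literal :=
| LPos (p : rel_sym Sg) of {ffun 'I_(rel_arity p) -> term}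
| LNeg (p : rel_sym Sg) of {ffun 'I_(rel_arity p) -> term}.

Definition literal_formula (a : literal) : formula :=
  match a with
  | LPos p args => FRel args
  | LNeg p args => FNot (FRel args)
  end.

(* Goedel numbering; symbols and variables are numbered by [pickle], i.e. the
   countable structures of the symbol types are part of the presentation. *)
Fixpoint term_tree (t : term) : GenTree.tree nat :=
  match t with
  | TVar v => GenTree.Leaf (pickle v)
  | TApp f a =>
      GenTree.Node (pickle f) [seq term_tree (a i) | i <- enum 'I_(fun_arity f)]
  end.

Definition atom_tree (k : nat) (p : rel_sym Sg)
    (a : {ffun 'I_(rel_arity p) -> term}) : GenTree.tree nat :=
  GenTree.Node k (GenTree.Leaf (pickle p) ::
                  [seq term_tree (a i) | i <- enum 'I_(rel_arity p)]).

Fixpoint formula_tree (phi : formula) : GenTree.tree nat :=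
  match phi with
  | FRel p a => atom_tree 0 a
  | FTrue => GenTree.Node 1 [::]
  | FNot f => GenTree.Node 2 [:: formula_tree f]
  | FAnd f g => GenTree.Node 3 [:: formula_tree f; formula_tree g]
  | FOr f g => GenTree.Node 4 [:: formula_tree f; formula_tree g]
  | FImp f g => GenTree.Node 5 [:: formula_tree f; formula_tree g]
  | FEx v f => GenTree.Node 6 [:: GenTree.Leaf (pickle v); formula_tree f]
  | FAll v f => GenTree.Node 7 [:: GenTree.Leaf (pickle v); formula_tree f]
  end.

Definition formula_code (phi : formula) : nat := pickle (formula_tree phi).

Definition literal_tree (a : literal) : GenTree.tree nat :=
  match a with
  | LPos p args => atom_tree 0 args
  | LNeg p args => atom_tree 1 args
  end.

Lemma term_tree_inj : injective term_tree.
Proof.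
rewrite /injective; fix IH 1 => -[v1|f1 a1] [v2|f2 a2] //=.
  by case=> /(pcan_inj pickleK) ->.
case=> /(pcan_inj pickleK) ef; case: f2 / ef a2 => a2 /eq_in_map ea.
by congr TApp; apply/ffunP => i; apply: IH; apply: ea; rewrite mem_enum.
Qed.

Lemma atom_tree_inj k1 k2 p1 p2 (a1 : {ffun 'I_(rel_arity p1) -> term})
    (a2 : {ffun 'I_(rel_arity p2) -> term}) :
  atom_tree k1 a1 = atom_tree k2 a2 ->
  k1 = k2 /\ existT (fun p => {ffun 'I_(rel_arity p) -> term}) p1 a1
             = existT (fun p => {ffun 'I_(rel_arity p) -> term}) p2 a2.
Proof.
case=> -> /(pcan_inj pickleK) ep; case: p2 / ep a2 => a2 /eq_in_map ea.
split=> //; congr existT; apply/ffunP => i.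
by apply: term_tree_inj; apply: ea; rewrite mem_enum.
Qed.

Lemma literal_tree_inj : injective literal_tree.
Proof.
pose mk b (u : {p & {ffun 'I_(rel_arity p) -> term}}) :=
  if b then LPos (tagged u) else LNeg (tagged u).
case=> [p1 a1|p1 a1] [p2 a2|p2 a2] /atom_tree_inj [] // _.
  by move=> /(congr1 (mk true)).
by move=> /(congr1 (mk false)).
Qed.

HB.instance Definition _ := hasDecEq.Build literal (inj_eqAxiom literal_tree_inj).

End Syntax.

Arguments FTrue {Sg V}.

(* A theory is presented by its structure on the domain: truth in the theory is
   truth in that structure. *)
Record theory := Theory {
  sig_of :> signature;
  domain : Type;
  domain_inhabited : inhabited domain;
  fun_interp : forall f : fun_sym sig_of,
    {ffun 'I_(fun_arity f) -> domain} -> domain;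
  rel_interp : forall p : rel_sym sig_of,
    {ffun 'I_(rel_arity p) -> domain} -> Prop }.

Section Semantics.
Variables (T : theory) (V : countType).

Definition update (env : V -> domain T) (v : V) (d : domain T) : V -> domain T :=
  fun w => if w == v then d else env w.

Fixpoint term_eval (env : V -> domain T) (t : term T V) : domain T :=
  match t with
  | TVar v => env v
  | TApp f a => fun_interp [ffun i => term_eval env (a i)]
  end.

Fixpoint sat (env : V -> domain T) (phi : formula T V) : Prop :=
  match phi with
  | FRel p a => rel_interp [ffun i => term_eval env (a i)]
  | FTrue => True
  | FNot f => ~ sat env f
  | FAnd f g => sat env f /\ sat env g
  | FOr f g => sat env f \/ sat env g
  | FImp f g => sat env f -> sat env g
  | FEx v f => exists d, sat (update env v d) f
  | FAll v f => forall d, sat (update env v d) f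
  end.

Definition true_in (phi : formula T V) : Prop := forall env, sat env phi.

End Semantics.

(* Kleene's total recursive functions: closure of the basic functions under
   composition, primitive recursion and minimization of regular functions.
   Minimization is stated by its graph, which also makes the class closed under
   extensional equality. *)
Inductive recursive : forall k : nat, (k.-tuple nat -> nat) -> Prop :=
| rec_zero k : recursive (fun _ : k.-tuple nat => 0)
| rec_succ : recursive (fun v : 1.-tuple nat => (thead v).+1)
| rec_proj k (i : 'I_k) : recursive (fun v : k.-tuple nat => tnth v i)
| rec_comp k j (f : j.-tuple nat -> nat) (g : 'I_j -> k.-tuple nat -> nat) :
    recursive f -> (forall i, recursive (g i)) ->
    recursive (fun v => f [tuple g i v | i < j])
| rec_prim k (f : k.-tuple nat -> nat) (g : k.+2.-tuple nat -> nat) :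
    recursive f -> recursive g ->
    recursive (fun v : k.+1.-tuple nat =>
      nat_rect (fun _ => nat) (f [tuple of behead v])
        (fun i r => g [tuple of i :: r :: behead v]) (thead v))
| rec_min k (f : k.+1.-tuple nat -> nat) (h : k.-tuple nat -> nat) :
    recursive f ->
    (forall v, f [tuple of h v :: v] = 0 /\
               forall i, i < h v -> f [tuple of i :: v] <> 0) ->
    recursive h.

Definition EA_decidable (T : theory) : Prop :=
  exists dec : 1.-tuple nat -> nat, recursive dec /\
    forall phi : formula T nat, EA_sentence phi ->
      (true_in phi -> dec [tuple formula_code phi] = 1) /\
      (~ true_in phi -> dec [tuple formula_code phi] = 0).

Inductive ltl (A : Type) :=
| LTrue
| LAtom of A
| LNot of ltl A
| LOr of ltl A & ltl A
| LNext of ltl A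
| LUntil of ltl A & ltl A.

Arguments LTrue {A}.

Section LTL.
Variable A : Type.
Implicit Types (phi psi : ltl A).

Definition LAnd phi psi := LNot (LOr (LNot phi) (LNot psi)).
Definition LImp phi psi := LOr (LNot phi) psi.
Definition LEventually phi := LUntil LTrue phi.
Definition LAlways phi := LNot (LEventually (LNot phi)).
Definition LConj (s : seq (ltl A)) : ltl A := foldr LAnd LTrue s.
Definition LDisj (s : seq (ltl A)) : ltl A := foldr (@LOr A) (LNot LTrue) s.

Fixpoint ltl_atoms phi : seq A :=
  match phi with
  | LTrue => [::]
  | LAtom a => [:: a]
  | LNot f | LNext f => ltl_atoms f
  | LOr f g | LUntil f g => ltl_atoms f ++ ltl_atoms g
  end.

Fixpoint ltl_sat (w : nat -> A -> Prop) (i : nat) phi : Prop :=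
  match phi with
  | LTrue => True
  | LAtom a => w i a
  | LNot f => ~ ltl_sat w i f
  | LOr f g => ltl_sat w i f \/ ltl_sat w i g
  | LNext f => ltl_sat w i.+1 f
  | LUntil f g => exists2 j, i <= j & ltl_sat w j g /\
                    forall k, i <= k < j -> ltl_sat w k f
  end.

End LTL.

Fixpoint ltl_subst (A B : Type) (s : A -> ltl B) (phi : ltl A) : ltl B :=
  match phi with
  | LTrue => LTrue
  | LAtom a => s a
  | LNot f => LNot (ltl_subst s f)
  | LOr f g => LOr (ltl_subst s f) (ltl_subst s g)
  | LNext f => LNext (ltl_subst s f)
  | LUntil f g => LUntil (ltl_subst s f) (ltl_subst s g)
  end.

Record bool_controller (E S : finType) := BoolController {
  bc_state : finType;
  bc_init : bc_state;
  bc_next : bc_state -> {ffun E -> bool} -> bc_state;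
  bc_out : bc_state -> {ffun E -> bool} -> {ffun S -> bool} }.

Section BoolController.
Variables (E S : finType) (C : bool_controller E S).

Fixpoint bc_run (ein : nat -> {ffun E -> bool}) (i : nat) : bc_state C :=
  if i is j.+1 then bc_next (bc_run ein j) (ein j) else bc_init C.

Definition bc_play (ein : nat -> {ffun E -> bool}) (i : nat) (p : E + S) : Prop :=
  match p with
  | inl e => ein i e
  | inr s => bc_out (bc_run ein i) (ein i) s
  end.

Definition bc_winning (phi : ltl (E + S)) : Prop :=
  forall ein, ltl_sat (bc_play ein) 0 phi.

End BoolController.

(* The environment variables are [inl i], [i : 'I_m], the system variables are
   [inr j], [j : 'I_k]. *)
Notation var m k := ('I_m + 'I_k)%type.
Notation xval T m := ('I_m -> domain T).
Notation yval T k := ('I_k -> domain T).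

Definition join_val (T : theory) m k (vx : xval T m) (vy : yval T k) :
    var m k -> domain T :=
  fun v => match v with inl i => vx i | inr j => vy j end.

Notation choice_set n := {set 'I_n}.
Notation reaction n := {set {set 'I_n}}.

Section Abstraction.
Variables (T : theory) (m k n : nat) (l : n.-tuple (literal T (var m k))).

Definition xvars : seq (var m k) := [seq inl i | i <- enum 'I_m].
Definition yvars : seq (var m k) := [seq inr j | j <- enum 'I_k].

Definition lit (i : 'I_n) : formula T (var m k) := literal_formula (tnth l i).

Definition f_choice (c : choice_set n) : formula T (var m k) :=
  FAnd (FConj [seq lit i | i <- enum c])
       (FConj [seq FNot (lit i) | i <- enum (~: c)]).

Definition f_reaction (r : reaction n) : formula T (var m k) :=
  FAnd (FConj [seq FExs yvars (f_choice c) | c <- enum r])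
       (FConj [seq FAlls yvars (FNot (f_choice c)) | c <- enum (~: r)]).

Definition valid_reaction (r : reaction n) : Prop :=
  true_in (FExs xvars (f_reaction r)).

Definition VR : {set reaction n} := [set r | `[< valid_reaction r >]].

(* The proposition e_r is the element [r] of this type, s_i is [i : 'I_n]. *)
Definition eprop : finType := {r : reaction n | r \in VR}.

Notation bltl := (ltl (eprop + 'I_n)).

Definition e_atom (e : eprop) : bltl := LAtom (inl e).
Definition s_atom (i : 'I_n) : bltl := LAtom (inr i).

Definition phi_legal : bltl :=
  LDisj [seq LAnd (e_atom e) (LConj [seq LNot (e_atom e') | e' <- enum (predC1 e)])
        | e <- enum eprop].

Definition choice_ltl (c : choice_set n) : bltl :=
  LAnd (LConj [seq s_atom i | i <- enum c])
       (LConj [seq LNot (s_atom i) | i <- enum (~: c)]).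

Definition phi_extra : bltl :=
  LConj [seq LImp (e_atom e) (LDisj [seq choice_ltl c | c <- enum (val e)])
        | e <- enum eprop].

(* The default case is only used for literals outside of [l], which do not
   occur in the specifications considered. *)
Definition abs_literal (a : literal T (var m k)) : bltl :=
  if insub (index a l) is Some i then s_atom i else LTrue.

Definition bool_abstraction (phi : ltl (literal T (var m k))) : bltl :=
  LAnd (ltl_subst abs_literal phi) (LAlways (LImp phi_legal phi_extra)).

End Abstraction.

Definition trace_sat (T : theory) m k (sigma : nat -> xval T m * yval T k)
    (phi : ltl (literal T (var m k))) : Prop :=
  ltl_sat (fun i a =>
    sat (join_val (sigma i).1 (sigma i).2) (literal_formula a)) 0 phi.

(* Reactive machines reading [X] and writing [Y]; the step relation
   [rm_step q x y q'] need be neither total nor deterministic, and the state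
   space need not be finite. *)
Record machine (X Y : Type) := Machine {
  rm_state : Type;
  rm_init : rm_state;
  rm_step : rm_state -> X -> Y -> rm_state -> Prop }.

Section Machine.
Variables (X Y : Type) (M : machine X Y).

Inductive reachable : rm_state M -> Prop :=
| reach_init : reachable (rm_init M)
| reach_step q x y q' : reachable q -> rm_step q x y q' -> reachable q'.

Definition is_trace (sigma : nat -> X * Y) : Prop :=
  exists q : nat -> rm_state M, q 0 = rm_init M /\
    forall i, rm_step (q i) (sigma i).1 (sigma i).2 (q i.+1).

End Machine.

(* Besides the correctness of all traces, a controller must be able to answer
   every input in every state that it can reach. *)
Definition is_controller_for (T : theory) m k
    (M : machine (xval T m) (yval T k)) (phi : ltl (literal T (var m k))) : Prop :=
  (forall q, reachable (M := M) q ->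
     forall vx, exists vy q', rm_step q vx vy q') /\
  (forall sigma, is_trace M sigma -> trace_sat sigma phi).

(* An arbitrary external controller: its (possibly infinite) memory is updated
   with the input and with the output that was actually played. *)
Record ext_controller (X Y : Type) := ExtController {
  ec_state : Type;
  ec_init : ec_state;
  ec_next : ec_state -> X -> Y -> ec_state;
  ec_out : ec_state -> X -> Y }.

Section Shield.
Variables (T : theory) (m k n : nat) (l : n.-tuple (literal T (var m k))).
Variable C : bool_controller (eprop l) 'I_n.

Definition partition_to (vx : xval T m) (e : eprop l) : Prop :=
  forall vy : yval T k, sat (join_val vx vy) (f_reaction l (val e)).

Definition bool_input (e : eprop l) : {ffun eprop l -> bool} :=
  [ffun e' => e' == e].

Definition choice_of (vs : {ffun 'I_n -> bool}) : choice_set n :=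
  [set i | vs i].

Definition shield_ok (r : reaction n) (c : choice_set n)
    (vx : xval T m) (vy : yval T k) : Prop :=
  sat (join_val vx vy) (FImp (f_reaction l r) (f_choice l c)).

Definition shield_step (q : bc_state C) (inp : xval T m * yval T k)
    (out : yval T k) (q' : bc_state C) : Prop :=
  let: (vx, vy) := inp in
  exists e : eprop l,
    let ve := bool_input e in
    let c := choice_of (bc_out q ve) in
    [/\ partition_to vx e,
        q' = bc_next q ve,
        shield_ok (val e) c vx vy -> out = vy
      & ~ shield_ok (val e) c vx vy -> shield_ok (val e) c vx out].

Definition shield : machine (xval T m * yval T k) (yval T k) :=
  {| rm_state := bc_state C; rm_init := bc_init C; rm_step := shield_step |}.

End Shield.

Definition compose (X Y : Type) (D : ext_controller X Y)
    (S : machine (X * Y) Y) : machine X Y :=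
  {| rm_state := ec_state D * rm_state S;
     rm_init := (ec_init D, rm_init S);
     rm_step := fun q x y q' =>
       rm_step q.2 (x, ec_out q.1 x) y q'.2 /\ q'.1 = ec_next q.1 x y |}.

(* Main.v *)
(** Replacing each letter of a trace by the pair (valid reaction of the input,
    choice of the controller) turns a trace of the shielded system into a play
    of the Boolean controller in which the proposition [s_i] is true exactly
    when the literal [l_i] holds in the trace; satisfaction of the Boolean
    abstraction thus carries over to the specification. For the shield never to
    be stuck, the choice of the controller must belong to the current reaction
    in every reachable state: a finite history that reaches the state extends to
    an infinite play with legal inputs, and there the conjunct
    [always (legal -> extra)] of the abstraction applies. *)

Require Import Defs.
From mathcomp Require Import all_boot.
From mathcomp Require Import boolp.

Set Implicit Arguments.
Unset Strict Implicit.
Unset Printing Implicit Defensive.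

(** * Semantics of finite conjunctions and of quantifier blocks *)

Section FirstOrder.
Variables (T : theory) (V : countType).
Implicit Types (env : V -> domain T) (f : formula T V).

Lemma sat_FConj_map (I : eqType) env (F : I -> formula T V) (s : seq I) :
  sat env (FConj [seq F i | i <- s]) <-> forall i, i \in s -> sat env (F i).
Proof.
elim: s => [|j s IH] /=; first by split.
split=> [[Fj /IH Fs] i|Fs]; first by rewrite inE => /predU1P[->|/Fs].
split; first by apply: Fs; rewrite mem_head.
by apply/IH => i si; apply: Fs; rewrite inE si orbT.
Qed.

(** Nested updates collapse to a single valuation. As only agreement off [vs] is recorded, neither
    the order of the variables nor repetitions in [vs] matter. *)
Lemma sat_FExs env (vs : seq V) f :
  sat env (FExs vs f) <->
  exists2 env', (forall v, v \notin vs -> env' v = env v) & sat env' f.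
Proof.
elim: vs env => [|v vs IH] env /=.
  split=> [fe|[env' e fe]]; first by exists env.
  by rewrite (_ : env = env') //; apply/funext => v; rewrite e.
split=> [[d /IH[env' e fe]]|[env' e fe]].
  exists env' => // w; rewrite inE negb_or => /andP[wv wvs].
  by rewrite e // /update (negPf wv).
exists (env' v); apply/IH; exists env' => // w wvs; rewrite /update.
by case: eqP => [->//|/eqP wv]; rewrite e // inE negb_or wv.
Qed.

Lemma sat_FAlls env (vs : seq V) f :
  sat env (FAlls vs f) <->
  forall env', (forall v, v \notin vs -> env' v = env v) -> sat env' f.
Proof.
elim: vs env => [|v vs IH] env /=.
  split=> [fe env' e|]; last exact.
  by rewrite (_ : env' = env) //; apply/funext => v; rewrite e.
split=> [H env' e|H d].
  apply: (IH (update env v (env' v))).1 => // w wvs; rewrite /update.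
  by case: eqP => [->//|/eqP wv]; rewrite e // inE negb_or wv.
apply/IH => env' e; apply: H => w; rewrite inE negb_or => /andP[wv wvs].
by rewrite e // /update (negPf wv).
Qed.

End FirstOrder.

(** * Semantics of the derived temporal operators and of substitution *)

Section TemporalLogic.
Variables (A : Type) (w : nat -> A -> Prop).

Lemma ltl_sat_LAnd i (f g : ltl A) :
  ltl_sat w i (LAnd f g) <-> ltl_sat w i f /\ ltl_sat w i g.
Proof.
split=> /= [H|[fi gi] []//].
by split; apply: contrapT => N; apply: H; [left|right].
Qed.

Lemma ltl_sat_LImp i (f g : ltl A) :
  ltl_sat w i (LImp f g) <-> (ltl_sat w i f -> ltl_sat w i g).
Proof.
split=> /= [[//|//]|H]; case: (pselect (ltl_sat w i f)) => fi; last by left.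
by right; apply: H.
Qed.

Lemma ltl_sat_LAlways i (f : ltl A) :
  ltl_sat w i (LAlways f) <-> forall j, i <= j -> ltl_sat w j f.
Proof.
split=> /= [H j ij|H [j ij [Nf _]]]; last by apply: Nf; apply: H.
by apply: contrapT => Nf; apply: H; exists j.
Qed.

Lemma ltl_sat_LConj_map (I : eqType) i (F : I -> ltl A) (s : seq I) :
  ltl_sat w i (LConj [seq F j | j <- s]) <->
  forall j, j \in s -> ltl_sat w i (F j).
Proof.
elim: s => [|j0 s IH]; first by split.
rewrite [LConj _]/(LAnd (F j0) (LConj [seq F j | j <- s])) ltl_sat_LAnd.
split=> [[Fj /IH Fs] j|Fs].
  by rewrite inE => /predU1P[->|/Fs].
split; first by apply: Fs; rewrite mem_head.
by apply/IH => j sj; apply: Fs; rewrite inE sj orbT.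
Qed.

Lemma ltl_sat_LDisj_map (I : eqType) i (F : I -> ltl A) (s : seq I) :
  ltl_sat w i (LDisj [seq F j | j <- s]) <->
  exists2 j, j \in s & ltl_sat w i (F j).
Proof.
elim: s => [|j0 s IH] /=; first by split=> [/(_ Logic.I)|[]].
split=> [[Fj|/IH[j sj Fj]]|[j]].
- by exists j0; rewrite // mem_head.
- by exists j; rewrite // inE sj orbT.
by rewrite inE => /predU1P[->|sj] Fj; [left|right; apply/IH; exists j].
Qed.

(** By induction on [f]. The hypothesis is restricted to atoms of [f] because [abs_literal] is
    meaningful only on the literals of [l]; it covers all positions because next and until look
    ahead. *)
Lemma ltl_sat_subst (B : eqType) (s : B -> ltl A) (u : nat -> B -> Prop)
    (f : ltl B) :
  (forall i a, a \in ltl_atoms f -> ltl_sat w i (s a) <-> u i a) ->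
  forall i, ltl_sat w i (ltl_subst s f) <-> ltl_sat u i f.
Proof.
elim: f => [|a|f IHf|f IHf g IHg|f IHf|f IHf g IHg] //= H i.
- by apply: H; rewrite mem_head.
- by rewrite IHf.
- by rewrite IHf ?IHg // => j a fga; apply: H; rewrite mem_cat fga ?orbT.
- exact: IHf.
have {}IHf j : ltl_sat w j (ltl_subst s f) <-> ltl_sat u j f.
  by apply: IHf => j' a fa; apply: H; rewrite mem_cat fa.
have {}IHg j : ltl_sat w j (ltl_subst s g) <-> ltl_sat u j g.
  by apply: IHg => j' a ga; apply: H; rewrite mem_cat ga orbT.
split=> -[j ij [/IHg gj fk]]; exists j => //; split=> // j' /fk.
  by move/IHf.
by move=> ?; apply/IHf.
Qed.

End TemporalLogic.

(** A state depends on past inputs only, so the future of a finite history can be altered freely. *)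
Lemma eq_bc_run (E S : finType) (C : bool_controller E S)
    (u v : nat -> {ffun E -> bool}) i :
  (forall j, j < i -> u j = v j) -> bc_run C u i = bc_run C v i.
Proof.
elim: i => [//|i IH] uv /=.
by rewrite uv // IH // => j ji; apply: uv; apply: ltnW.
Qed.

(** * Characteristic formulas and valid reactions *)

Section Abstraction.
Variables (T : theory) (m k n : nat) (l : n.-tuple (literal T ('I_m + 'I_k)%type)).
Implicit Types (vx : 'I_m -> domain T) (vy : 'I_k -> domain T).

Lemma join_val_restr (env : ('I_m + 'I_k)%type -> domain T) :
  env = join_val (fun i => env (inl i)) (fun j => env (inr j)).
Proof. by apply/funext => -[]. Qed.

Lemma inl_notin_yvars i : inl i \notin yvars m k.
Proof. by apply/mapP => -[]. Qed.

Lemma inr_in_yvars j : inr j \in yvars m k.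
Proof. by apply: map_f; rewrite mem_enum. Qed.

Lemma inl_in_xvars i : inl i \in xvars m k.
Proof. by apply: map_f; rewrite mem_enum. Qed.

Lemma agree_off_yvars vx vy env :
  (forall v, v \notin yvars m k -> env v = join_val vx vy v) <->
  exists vy', env = join_val vx vy'.
Proof.
split=> [H|[vy' ->] [i|j] //]; last by rewrite inr_in_yvars.
exists (fun j => env (inr j)); apply/funext => -[i|//].
by rewrite H ?inl_notin_yvars.
Qed.

Lemma sat_f_choice env (c : choice_set n) :
  sat env (f_choice l c) <-> forall i, i \in c <-> sat env (lit l i).
Proof.
rewrite /f_choice /= !sat_FConj_map; split=> [[Hc HNc] i|H].
  split=> [ic|li]; first by apply: Hc; rewrite mem_enum.
  by apply/negPn/negP => ic; apply: (HNc i) => //; rewrite mem_enum inE.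
split=> i; rewrite mem_enum; first by move/H.
by rewrite inE => /negP ic /H.
Qed.

(** All system variables are bound in each conjunct, so the right-hand side is free of [vy]; two
    reactions that hold at the same [vx] therefore coincide. *)
Lemma sat_f_reaction vx vy (r : reaction n) :
  sat (join_val vx vy) (f_reaction l r) <->
  forall c, c \in r <-> exists vy', sat (join_val vx vy') (f_choice l c).
Proof.
have ex c : sat (join_val vx vy) (FExs (yvars m k) (f_choice l c)) <->
    exists vy', sat (join_val vx vy') (f_choice l c).
  rewrite sat_FExs; split=> [[env /agree_off_yvars[vy' ->]]|[vy' fc]].
    by exists vy'.
  by exists (join_val vx vy') => //; apply/agree_off_yvars; exists vy'.
have al c : sat (join_val vx vy) (FAlls (yvars m k) (FNot (f_choice l c))) <->
    ~ exists vy', sat (join_val vx vy') (f_choice l c).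
  rewrite sat_FAlls; split=> [H [vy' fc]|H env /agree_off_yvars[vy' ->] fc].
    by apply: (H (join_val vx vy')) fc; apply/agree_off_yvars; exists vy'.
  by apply: H; exists vy'.
rewrite /f_reaction /= !sat_FConj_map; split=> [[Hr HNr] c|H].
  split=> [cr|/ex fc]; first by apply/ex/Hr; rewrite mem_enum.
  apply/negPn/negP => cr; have /al[] : sat (join_val vx vy)
    (FAlls (yvars m k) (FNot (f_choice l c))) by apply: HNr; rewrite mem_enum inE.
  exact/ex.
split=> c; rewrite mem_enum; first by move/H/ex.
by rewrite inE => /negP cr; apply/al => /H.
Qed.

Lemma valid_reactionP (r : reaction n) :
  valid_reaction l r <-> exists vx, forall vy, sat (join_val vx vy) (f_reaction l r).
Proof.
split=> [H|[vx H] env].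
  (* Truth ranges over all valuations; a constant one suffices to extract a witness. *)
  have [d] := domain_inhabited T.
  have /sat_FExs[env' _] := H (fun=> d).
  rewrite (join_val_restr env') => /sat_f_reaction fr.
  by eexists => vy; apply/sat_f_reaction; exact: fr.
apply/sat_FExs; exists (join_val vx (fun j => env (inr j))) => //.
by case=> [i|j] //; rewrite inl_in_xvars.
Qed.

Lemma ex_partition_to vx : exists e : eprop l, partition_to vx e.
Proof.
(* The reaction of [vx] collects the choices that some response realizes; [vx] itself witnesses its
   validity. *)
pose r : reaction n :=
  [set c | `[< exists vy, sat (join_val vx vy) (f_choice l c) >]].
have fr vy : sat (join_val vx vy) (f_reaction l r).
  by apply/sat_f_reaction => c; rewrite inE; split=> /asboolP.
have VRr : r \in VR l.
  by rewrite inE; apply/asboolP/valid_reactionP; exists vx.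
by exists (Sub r VRr).
Qed.

(** * The abstraction's formulas read on a single letter of a play *)

Section Play.
Variable w : nat -> eprop l + 'I_n -> Prop.

Lemma ltl_sat_choice_ltl i (c : choice_set n) :
  ltl_sat w i (choice_ltl l c) <-> forall j, j \in c <-> w i (inr j).
Proof.
rewrite /choice_ltl ltl_sat_LAnd !ltl_sat_LConj_map.
split=> [[Hc HNc] j|H].
  split=> [jc|wj]; first by apply: Hc; rewrite mem_enum.
  by apply/negPn/negP => jc; apply: (HNc j) => //; rewrite mem_enum inE.
split=> j; rewrite mem_enum; first by move/H.
by rewrite inE => /negP jc /H.
Qed.

Lemma ltl_sat_phi_legal i (e : eprop l) :
  (forall e', w i (inl e') <-> e' = e) -> ltl_sat w i (phi_legal l).
Proof.
move=> we; apply/ltl_sat_LDisj_map; exists e; first by rewrite mem_enum.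
apply/ltl_sat_LAnd; split; first exact/we.
apply/ltl_sat_LConj_map => e'; rewrite mem_enum !inE => /eqP ne.
by move/we.
Qed.

(** The letter determines its choice, so the disjunct that holds can only be the one of [c]. *)
Lemma ltl_sat_phi_extra i (e : eprop l) (c : choice_set n) :
    ltl_sat w i (phi_extra l) -> w i (inl e) ->
    (forall j, j \in c <-> w i (inr j)) ->
  c \in val e.
Proof.
move=> /ltl_sat_LConj_map/(_ e); rewrite mem_enum => /(_ isT)/ltl_sat_LImp.
move=> H /H/ltl_sat_LDisj_map[c']; rewrite mem_enum.
move=> c'e /ltl_sat_choice_ltl wc' wc.
suff -> : c = c' by [].
by apply/setP => j; apply/idP/idP; [move/wc/wc'|move/wc'/wc].
Qed.

End Play.

(** If [l] has repetitions, the witness is the first occurrence of [a], the one [abs_literal]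
    selects. *)
Lemma ltl_sat_abs_literal w i (a : literal T ('I_m + 'I_k)%type) : a \in l ->
  exists2 j, tnth l j = a & ltl_sat w i (abs_literal l a) <-> w i (inr j).
Proof.
move=> al; have an : index a l < n by rewrite -[n in _ < n](size_tuple l) index_mem.
exists (Ordinal an); first by rewrite (tnth_nth a) /= nth_index.
by rewrite /abs_literal (insubT (fun j => j < n) an).
Qed.

(** * Plays of the winning controller and traces of the shielded system *)

Section Controller.
Variables (C : bool_controller (eprop l) 'I_n).
Variable (phi : ltl (literal T ('I_m + 'I_k)%type)).
Hypothesis C_win : bc_winning C (bool_abstraction l phi).

(** Inputs of the form [bool_input] are legal at every position, so the invariant conjunct of the
    abstraction yields [phi_extra] there. *)
Lemma winning_choice (es : nat -> eprop l) i :
  choice_of (bc_out (bc_run C (fun j => bool_input (es j)) i) (bool_input (es i)))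
    \in val (es i).
Proof.
set ein := fun j => _.
have [_ /ltl_sat_LAlways] := (ltl_sat_LAnd _ _ _ _).1 (@C_win ein).
move=> /(_ i (leq0n i))/ltl_sat_LImp legal_extra.
apply: (ltl_sat_phi_extra (w := bc_play C ein) (i := i)).
- apply/legal_extra/(ltl_sat_phi_legal (e := es i)) => e /=.
  by rewrite ffunE; split=> /eqP.
- by rewrite /= ffunE eqxx.
by move=> j; rewrite inE.
Qed.

(** The reaction formula itself asserts that each of its choices has a response. *)
Lemma shield_satisfiable (e : eprop l) (c : choice_set n) vx :
  c \in val e -> partition_to vx e -> exists vy, shield_ok l (val e) c vx vy.
Proof.
have [d] := domain_inhabited T.
move=> ce /(_ (fun=> d))/sat_f_reaction/(_ c)[/(_ ce)[vy fc] _].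
by exists vy.
Qed.

Variable D : ext_controller ('I_m -> domain T) ('I_k -> domain T).

Lemma reachable_bc_run q : reachable (M := compose D (shield C)) q ->
  exists es i, q.2 = bc_run C (fun j => bool_input (es j)) i.
Proof.
elim=> [|q0 vx vy q' _ [es [i qi]] [[e [_ q'2 _ _]] _]].
  have [d] := domain_inhabited T; have [e _] := ex_partition_to (fun=> d).
  by exists (fun=> e), 0.
(* The old history is kept before [i], and the input of the new step is read at [i]. *)
exists (fun j => if j < i then es j else e), i.+1.
rewrite q'2 qi /= ltnn; congr bc_next; apply: eq_bc_run => j ji.
by rewrite ji.
Qed.

(** Here [e] is any next input: splicing it after a history that leads to [q] gives an infinite
    legal play, to which [winning_choice] applies. *)
Lemma reachable_choice q e : reachable (M := compose D (shield C)) q ->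
  choice_of (bc_out q.2 (bool_input e)) \in val e.
Proof.
move=> /reachable_bc_run[es [i ->]].
have := winning_choice (fun j => if j < i then es j else e) i.
rewrite /= ltnn (@eq_bc_run _ _ _ _ (fun j => bool_input (es j))) // => j ji.
by rewrite ji.
Qed.

Lemma compose_shield_total q : reachable (M := compose D (shield C)) q ->
  forall vx, exists vy q', rm_step (m := compose D (shield C)) q vx vy q'.
Proof.
move=> qr vx; have [e vxe] := ex_partition_to vx.
pose ve := bool_input e; pose c := choice_of (bc_out q.2 ve).
pose vyD := ec_out q.1 vx.
have [vy' ok'] := shield_satisfiable (reachable_choice e qr) vxe.
suff [vy [ok1 ok2]] : exists vy, (shield_ok l (val e) c vx vyD -> vy = vyD) /\
    (~ shield_ok l (val e) c vx vyD -> shield_ok l (val e) c vx vy).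
  exists vy, (ec_next q.1 vx vy, bc_next q.2 ve).
  by split=> //; exists e; split.
by case: (pselect (shield_ok l (val e) c vx vyD)) => ok; [exists vyD|exists vy'].
Qed.

(** Whether the proposal is kept or corrected, the output passes the check, and the partitioner
    discharges the premise [f_reaction] of that check. *)
Lemma shield_step_choice q vx vyD vy q' :
    shield_step (C := C) q (vx, vyD) vy q' ->
  exists e : eprop l, q' = bc_next q (bool_input e) /\
    sat (join_val vx vy) (f_choice l (choice_of (bc_out q (bool_input e)))).
Proof.
case=> e [vxe q'E ok1 ok2]; exists e; split=> //.
set c := choice_of _ in ok1 ok2 *.
have ok : shield_ok l (val e) c vx vy.
  by case: (pselect (shield_ok l (val e) c vx vyD)) => ok; [rewrite ok1|apply: ok2].
exact: ok (vxe vy).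
Qed.

Lemma compose_shield_sat sigma : (forall a, a \in ltl_atoms phi -> a \in l) ->
  is_trace (compose D (shield C)) sigma -> trace_sat sigma phi.
Proof.
move=> phi_l [q [q0 qS]].
(* The reactions met at the separate steps are gathered into one infinite input sequence for [C]. *)
have /choice[es es_q] i := shield_step_choice (qS i).1.
pose ein i := bool_input (es i).
have run i : (q i).2 = bc_run C ein i.
  by elim: i => [|i IH]; [rewrite q0|rewrite (es_q i).1 IH].
have [+ _] := (ltl_sat_LAnd _ _ _ _).1 (@C_win ein).
apply: (ltl_sat_subst _ 0).1 => i a /phi_l al.
have [j <- ->] := ltl_sat_abs_literal (bc_play C ein) i al.
(* The output satisfies the formula of the controller's choice, so the [j]-th system proposition of
   the play agrees with the [j]-th literal of the trace. *)
have /sat_f_choice/(_ j) := (es_q i).2.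
by rewrite inE run.
Qed.

End Controller.
End Abstraction.

Theorem theorem1 (T : theory) (T_dec : EA_decidable T) (m k n : nat)
    (l : n.-tuple (literal T ('I_m + 'I_k)%type))
    (phi : ltl (literal T ('I_m + 'I_k)%type))
    (phi_l : forall a, a \in ltl_atoms phi -> a \in l)
    (C : bool_controller (eprop l) 'I_n)
    (C_win : bc_winning C (bool_abstraction l phi))
    (D : ext_controller ('I_m -> domain T) ('I_k -> domain T)) :
  is_controller_for (compose D (shield C)) phi.
Proof.
split; first exact: (compose_shield_total C_win).
by move=> sigma; apply: (compose_shield_sat C_win).
Qed.
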